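(* Let $X,Y$ be finite subsets of a torsion-free abelian group, let $2\le a_X,a_Y<3$ and $K_X,K_Y\ge1$. Suppose that, for every $\eta>0$, there is a constant $C_\eta$ such that for all subsets $A\subset X$, $B\subset Y$, $$E(A)\le C_\eta K_X^{3-a_X}|A|^{a_X+\eta},\qquad E(B)\le C_\eta K_Y^{3-a_Y}|B|^{a_Y+\eta}.$$ Let $\theta_0,\theta_1,\theta_2\ge0$ with $\theta_0+\theta_1+\theta_2=1$, and define $p,q$ by $$\frac1p=\theta_0\frac{a_X}{4}+\theta_1+\frac{\theta_2}{2},\qquad \frac1q=\theta_0\frac{a_Y}{4}+\frac{\theta_1}{2}+\theta_2.$$ Then for every $\varepsilon>0$ there is a constant $C$, depending only on $\varepsilon$, $a_X,a_Y,\theta_0,\theta_1,\theta_2$ and the constants $(C_\eta)_{\eta>0}$, such that for all complex-valued $f,g$ supported on $X,Y$ respectively, $$\|f*g\|_{\ell^2}\le C\,K_X^{\theta_0(3-a_X)/4}K_Y^{\theta_0(3-a_Y)/4}(|X||Y|)^{\varepsilon}\|f\|_{\ell^p}\|g\|_{\ell^q}.$$ The same estimate holds after decreasing either $p$ or $q$, i.e. with $p,q$ on the right-hand side replaced by any $1\le p'\le p$, $1\le q'\le q$.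
   Context: $E(A)=\sum_t r_{A-A}(t)^2$ with $r_{A-A}(t)=\#\{(x,y)\in A^2:x-y=t\}$. Convolution is $(f*g)(z)=\sum_{x+y=z}f(x)g(y)$; $\ell^p$ norms are with respect to counting measure. *)

(* Defs.v *)
From HB Require Import structures.
From mathcomp Require Import all_boot all_order all_algebra.
From mathcomp Require Import finmap complex.
From mathcomp Require Import boolp classical_sets functions cardinality fsbigop.
From mathcomp Require Import reals exp.

Set Implicit Arguments.
Unset Strict Implicit.
Unset Printing Implicit Defensive.

Import Order.TTheory GRing.Theory Num.Theory.

Local Open Scope classical_set_scope.
Local Open Scope fset_scope.
Local Open Scope ring_scope.

Definition torsion_free (G : zmodType) : Prop :=
  forall (x : G) (n : nat), (0 < n)%N -> x *+ n = 0 -> x = 0.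

(* In the unbounded sums below, \sum_(i \in A) is the sum over the support of
   the summand in A, with value 0 if that support is infinite.  For a finite
   set A and for finitely supported f and g, all the supports are finite. *)

Definition rdiff (G : zmodType) (A : {fset G}) (t : G) : nat :=
  #|` [fset w in A `*` A | w.1 - w.2 == t]|.

Definition energy (G : zmodType) (A : {fset G}) : nat :=
  (\big[addn/0]_(t \in [set: G]) (rdiff A t ^ 2))%N.

Definition supported_on (G : zmodType) (V : zmodType) (f : G -> V)
    (X : {fset G}) : Prop :=
  forall x, x \notin X -> f x = 0.

Definition conv (G : zmodType) (K : nzRingType) (f g : G -> K) (z : G) : K :=
  \sum_(w \in [set w : G * G | w.1 + w.2 = z]) (f w.1 * g w.2).

Definition lpnorm (R : realType) (G : zmodType) (p : R) (f : G -> R[i]) : R :=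
  (\sum_(x \in [set: G]) (ComplexField.Normc.normc (f x) `^ p)) `^ p^-1.

(* Main.v *)
Require Import Defs.
From HB Require Import structures.
From mathcomp Require Import all_boot all_order all_algebra.
From mathcomp Require Import finmap complex.
From mathcomp Require Import boolp classical_sets functions cardinality fsbigop.
From mathcomp Require Import reals exp.
From mathcomp Require Import ring lra.

Set Implicit Arguments.
Unset Strict Implicit.
Unset Printing Implicit Defensive.

Import Order.TTheory GRing.Theory Num.Theory.

Local Open Scope fset_scope.
Local Open Scope ring_scope.

(** Everything takes place at the level of squares: for nonnegative F on X and
    H on Y put Q(F, H) = ||F * H||_2^2.  By the triangle inequality
    ||f * g||_2^2 <= Q(|f|, |g|) ([lpnorm2_conv_le]), so only nonnegative
    functions matter, and Q is monotone in each argument.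

    For indicator functions there are three bounds.  Writing Q(1_A, 1_B) as
    the sum over t of r_{A-A}(t) r_{B-B}(t), because x + y = x' + y' says
    x - x' = y' - y, Cauchy-Schwarz gives
    Q(1_A, 1_B)^2 <= E(A) E(B) ([sum_repsum_sqr_energy]).
    Counting solutions gives |A|^2 |B| and, symmetrically, |A| |B|^2
    ([sum_repsum_sqr_le]).  The weighted geometric mean of the three with
    weights theta0, theta1, theta2 is exactly |A|^(2/p) |B|^(2/q), up to the
    constants of the energy hypothesis and powers |A|^O(eta), |B|^O(eta)
    ([convsq_indic_le]).  As |A| and |B| are 0 or at least 1, the bound
    survives when p and q are decreased, so the two parts of the theorem are
    one statement about p' <= p and q' <= q ([lpnorm2_conv_le_energy]).

    To pass from sets to functions, cut F at the J + 1 heights M b^-j, where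
    M = ||F||_p and b = |X|^(1/J) ([level_decomposition]).  Consecutive heights
    differ by b, which is an arbitrarily small power of |X|, while their
    number depends on J only, so no logarithm appears.  The set where
    F > M b^-(j+1) has at most b^(p (j+1)) elements by Chebyshev, hence each
    level contributes at most a constant times b^2 M^2 to Q, and the last
    height M / |X| is so small that all of X may be used there.  The square of
    a sum of J + 1 terms is at most J + 1 times the sum of the squares, and
    that is all the subadditivity which is needed.  Doing this in F with H
    fixed and in H with F an indicator yields the theorem
    ([convsq_le_levels]), with J of size 2 / eps. *)

(** * Inequalities for finite sums *)

Ltac nonneg :=
  repeat first [ assumption | exact: sqr_ge0 | exact: powR_ge0 | exact: ler0n
               | apply: ltW; assumption
               | apply: mulr_ge0 | apply: addr_ge0 | apply: exprn_ge0 ].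

Lemma cauchy_schwarz_seq (R : realDomainType) (I : Type) (s : seq I)
    (a b : I -> R) :
  (\sum_(i <- s) a i * b i) ^+ 2 <=
    (\sum_(i <- s) a i ^+ 2) * (\sum_(i <- s) b i ^+ 2).
Proof.
elim: s => [|i s IHs]; first by rewrite !big_nil expr0n mul0r.
rewrite !big_cons.
have U0 : 0 <= \sum_(j <- s) a j ^+ 2 by apply: sumr_ge0 => j _; exact: sqr_ge0.
have V0 : 0 <= \sum_(j <- s) b j ^+ 2 by apply: sumr_ge0 => j _; exact: sqr_ge0.
move: (\sum_(j <- s) a j * b j) (\sum_(j <- s) a j ^+ 2)
  (\sum_(j <- s) b j ^+ 2) (a i) (b i) IHs U0 V0 => u U V x y uUV U0 V0.
have W0 : 0 <= U * y ^+ 2 + V * x ^+ 2.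
  by apply: addr_ge0; apply: mulr_ge0 => //; exact: sqr_ge0.
(* (2 u x y)^2 <= 4 U V x^2 y^2 <= (U y^2 + V x^2)^2 *)
have cross : 2 * (u * (x * y)) <= U * y ^+ 2 + V * x ^+ 2.
  apply: le_trans (ler_norm _) _.
  rewrite -ler_sqr ?nnegrE ?normr_ge0 // real_normK ?num_real //.
  have xy0 : 0 <= (x * y) ^+ 2 by exact: sqr_ge0.
  have := ler_wpM2r xy0 uUV.
  have : 0 <= (U * y ^+ 2 - V * x ^+ 2) ^+ 2 by exact: sqr_ge0.
  rewrite !exprMn; nra.
nra.
Qed.

Lemma sqr_sum_le (R : realDomainType) (m : nat) (u : 'I_m -> R) :
  (\sum_j u j) ^+ 2 <= m%:R * \sum_j u j ^+ 2.
Proof.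
have := cauchy_schwarz_seq (index_enum 'I_m) u (fun=> 1).
under eq_bigr do rewrite mulr1.
under [X in _ * X]eq_bigr do rewrite expr1n.
by rewrite sumr_const card_ord mulrC.
Qed.

Lemma sum_pick (R : pzRingType) (T : choiceType) (Z : {fset T}) (a : T)
    (F : T -> R) :
  \sum_(z <- Z) (a == z)%:R * F z = (a \in Z)%:R * F a.
Proof.
have [aZ|aZ] := boolP (a \in Z).
  rewrite (big_fsetD1 a) //= eqxx big1_fset ?addr0 // => z.
  by rewrite !inE => /andP[za _] _; rewrite eq_sym (negbTE za) mul0r.
rewrite mul0r big1_fset // => z zZ _.
by case: eqP aZ => [->|_ _]; rewrite ?zZ // mul0r.
Qed.

Lemma sum_const_fset (R : pzRingType) (T : choiceType) (A : {fset T}) (a : R) :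
  \sum_(x <- A) a = a * #|` A|%:R.
Proof. by rewrite big_const_seq count_predT iter_addr_0 mulr_natr. Qed.

(** Q = Q^t0 Q^t1 Q^t2, and each factor is bounded on its own. *)
Lemma interpolate3 (R : realType) (Q M0 M1 M2 t0 t1 t2 : R) :
  0 <= Q -> Q <= M0 -> Q <= M1 -> Q <= M2 ->
  0 <= t0 -> 0 <= t1 -> 0 <= t2 -> t0 + t1 + t2 = 1 ->
  Q <= M0 `^ t0 * M1 `^ t1 * M2 `^ t2.
Proof.
move=> Q0 QM0 QM1 QM2 t00 t10 t20 t1E.
have [->|Qn0] := eqVneq Q 0; first by rewrite !mulr_ge0 ?powR_ge0.
have -> : Q = Q `^ t0 * Q `^ t1 * Q `^ t2.
  by rewrite -!powRD ?t1E ?powRr1 // Qn0 implybT.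
have mono t M : 0 <= t -> Q <= M -> Q `^ t <= M `^ t.
  by move=> tge QM; apply: ge0_ler_powR; rewrite ?nnegrE // (le_trans Q0).
by rewrite !ler_pM ?mulr_ge0 ?powR_ge0 ?mono.
Qed.

(** * From indicator functions to nonnegative functions *)

Definition indic (R : pzRingType) (T : choiceType) (A : {fset T}) (x : T) : R :=
  (x \in A)%:R.

(** The passage from a bound on indicators to a bound on functions, for any
    functional [Phi] that behaves like the square of a seminorm up to a factor
    counting the terms.  With M the p-norm of F and b = |X|^(1/J), F is
    dominated by the sum over j <= J of M b^-j times the indicator of
    L_j = {F > M b^-(j+1)}, and Chebyshev turns |L_j|^(1/p) into at most
    b^(j+1).  The bottom level L_J is all of X: its height is M / |X|, and
    |X|^(1/p) <= |X|. *)
Lemma level_decomposition (R : realType) (T : choiceType) (X : {fset T})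
    (p D : R) (J : nat) (Phi : (T -> R) -> R) :
  (forall F1 F2 : T -> R,
     (forall x, x \in X -> 0 <= F1 x <= F2 x) -> Phi F1 <= Phi F2) ->
  (forall m (c : 'I_m -> R) (A : 'I_m -> {fset T}),
     Phi (fun x => \sum_j c j * indic R (A j) x) <=
       m%:R * \sum_j c j ^+ 2 * Phi (indic R (A j))) ->
  1 <= p -> 0 <= D -> (0 < J)%N ->
  (forall A : {fset T}, A `<=` X ->
     Phi (indic R A) <= D * (#|` A|%:R `^ p^-1) ^+ 2) ->
  forall F : T -> R, (forall x, x \in X -> 0 <= F x) ->
  Phi F <= J.+1%:R ^+ 2 * D * (#|` X|%:R `^ J%:R^-1) ^+ 2 *
           ((\sum_(x <- X) F x `^ p) `^ p^-1) ^+ 2.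
Proof.
move=> Phi_mono Phi_sum p1 D0 J0 Phi_set F F0.
have p0 : 0 < p by exact: lt_le_trans p1.
have [X0|/fset0Pn[x0 x0X]] := eqVneq X fset0.
  have /le_trans -> // : Phi F <= D * (#|` fset0 : {fset T}|%:R `^ p^-1) ^+ 2.
    apply: le_trans (Phi_set _ (fsub0set _)).
    by apply: Phi_mono => x; rewrite X0 inE.
  rewrite cardfs0 powR0 ?gt_eqF ?invr_gt0 // expr0n mulr0.
  by nonneg.
set b : R := #|` X|%:R `^ J%:R^-1.
set M : R := (\sum_(x <- X) F x `^ p) `^ p^-1.
have M0 : 0 <= M by exact: powR_ge0.
have n1 : 1 <= #|` X|%:R :> R.
  by rewrite ler1n cardfs_gt0; apply/fset0Pn; exists x0.
have b1 : 1 <= b.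
  rewrite -(powRr0 #|` X|%:R); apply: ler_powR => //.
  by rewrite invr_ge0.
have b0 : 0 < b by exact: lt_le_trans b1.
have bJ : b ^+ J = #|` X|%:R.
  rewrite -powR_mulrn ?(ltW b0) // -powRrM mulVf ?powRr1 //.
  by rewrite pnatr_eq0 -lt0n.
have SM : \sum_(x <- X) F x `^ p = M `^ p.
  rewrite -powRrM mulVf ?gt_eqF // powRr1 //.
  by apply: sumr_ge0 => x _; exact: powR_ge0.
pose inL (j : nat) x := (j == J) || (M * b ^- j.+1 < F x).
pose L (j : 'I_J.+1) : {fset T} := [fset x in X | inL j x].
pose c (j : 'I_J.+1) : R := M * b ^- j.
have c0 j : 0 <= c j by rewrite mulr_ge0 // invr_ge0 exprn_ge0 ?(ltW b0).
(* x lies in the first level set that contains it, and it escaped the previous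
   one, which bounds F x by the height M b^-j of its level. *)
have cover x : x \in X ->
    0 <= F x <= \sum_(j < J.+1) c j * indic R (L j) x.
  move=> xX; rewrite F0 //=.
  have exj : exists j, inL j x by exists J; rewrite /inL eqxx.
  case: (ex_minnP exj) => j jL jmin.
  have jJ : (j < J.+1)%N by rewrite ltnS jmin // /inL eqxx.
  rewrite (bigD1 (Ordinal jJ)) //=.
  have -> : indic R (L (Ordinal jJ)) x = 1 by rewrite /indic !inE /= xX jL.
  rewrite mulr1 -[F x]addr0 lerD //; last first.
    by apply: sumr_ge0 => i _; rewrite mulr_ge0 // /indic ler0n.
  rewrite /c /=.
  case: j jL jmin jJ => [|j] jL jmin jJ.
    rewrite expr0 invr1 mulr1.
    have FxM : F x `^ p <= M `^ p.
      rewrite -SM (big_fsetD1 x) //= lerDl.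
      by apply: sumr_ge0 => y _; exact: powR_ge0.
    rewrite leNgt; apply/negP => MF.
    by move: FxM; rewrite leNgt gt0_ltr_powR ?nnegrE ?F0.
  rewrite leNgt; apply/negP => MF.
  by have := jmin j; rewrite /inL MF orbT ltnn => /(_ isT).
(* b is lost because the height of L_j is b times its threshold. *)
have size_L j : c j * #|` L j|%:R `^ p^-1 <= M * b.
  have [jJ|jJ] := eqVneq (j : nat) J.
    rewrite /c jJ bJ -mulrA ler_wpM2l //.
    have LX : #|` L j|%:R <= #|` X|%:R :> R.
      by rewrite ler_nat fsubset_leq_card // fset_sub.
    have pw : #|` L j|%:R `^ p^-1 <= #|` X|%:R :> R.
      apply: le_trans (ler1_powR n1 (_ : p^-1 <= 1)); last first.
        by rewrite invf_le1.
      by apply: ge0_ler_powR; rewrite ?nnegrE ?invr_ge0 ?ler0n ?(ltW p0).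
    apply: le_trans b1.
    by rewrite mulrC ler_pdivrMr ?mul1r // (lt_le_trans ltr01).
  have -> : c j = M * b ^- j.+1 * b.
    by rewrite /c exprSr invfM -!mulrA mulVf ?mulr1 // gt_eqF.
  rewrite mulrAC ler_wpM2r ?(ltW b0) //.
  set t := M * b ^- j.+1.
  have t0 : 0 <= t by rewrite mulr_ge0 // invr_ge0 exprn_ge0 ?(ltW b0).
  have LM : t `^ p * #|` L j|%:R <= M `^ p.
    rewrite -SM (big_fsetID _ (inL j)) /=.
    apply: ler_wpDr; first by apply: sumr_ge0 => y _; exact: powR_ge0.
    have -> : t `^ p * #|` L j|%:R = \sum_(x <- L j) t `^ p.
      by rewrite sum_const_fset.
    rewrite big_seq_cond [leRHS]big_seq_cond; apply: ler_sum => x.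
    rewrite andbT !inE /inL (negbTE jJ) /= => /andP[xX tF].
    by apply: ge0_ler_powR; rewrite ?nnegrE ?F0 ?(ltW p0) ?(ltW tF).
  have -> : t * #|` L j|%:R `^ p^-1 = (t `^ p * #|` L j|%:R) `^ p^-1.
    by rewrite powRM ?powR_ge0 // -powRrM divff ?powRr1 // gt_eqF.
  have -> : M = (M `^ p) `^ p^-1 by rewrite -powRrM divff ?powRr1 // gt_eqF.
  by apply: ge0_ler_powR => //; rewrite ?nnegrE ?invr_ge0 ?(ltW p0) //; nonneg.
apply: (le_trans (Phi_mono _ _ cover)).
apply: (le_trans (Phi_sum _ _ _)).
have -> : J.+1%:R ^+ 2 * D * b ^+ 2 * M ^+ 2 =
    J.+1%:R * \sum_(j < J.+1) D * (M * b) ^+ 2.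
  by rewrite sumr_const card_ord -[_ *+ _]mulr_natr; ring.
apply: ler_wpM2l; [exact: ler0n | apply: ler_sum => j _].
apply: (@le_trans _ _ (c j ^+ 2 * (D * (#|` L j|%:R `^ p^-1) ^+ 2))).
  by apply: ler_wpM2l; [exact: sqr_ge0 | apply: Phi_set; exact: fset_sub].
rewrite mulrCA -exprMn; apply: ler_wpM2l => //.
apply: lerXn2r; [| |exact: size_L]; rewrite nnegrE; last by nonneg.
by rewrite mulr_ge0 ?c0 ?powR_ge0.
Qed.

(** * Squared norm of a convolution *)

Definition sumset (G : zmodType) (X Y : {fset G}) : {fset G} :=
  [fset x + y | x in X, y in Y].

Definition fconv (R : pzRingType) (G : zmodType) (X Y : {fset G})
    (F H : G -> R) (z : G) : R :=
  \sum_(x <- X) \sum_(y <- Y) (x + y == z)%:R * (F x * H y).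

Definition convsq (R : pzRingType) (G : zmodType) (X Y : {fset G})
    (F H : G -> R) : R :=
  \sum_(z <- sumset X Y) fconv X Y F H z ^+ 2.

Lemma sumsetC (G : zmodType) (X Y : {fset G}) : sumset X Y = sumset Y X.
Proof.
by apply/fsetP => z; apply/imfset2P/imfset2P => -[x xX [y yY ->]];
   exists y => //; exists x => //; rewrite addrC.
Qed.

Lemma convsqC (R : comPzRingType) (G : zmodType) (X Y : {fset G})
    (F H : G -> R) : convsq X Y F H = convsq Y X H F.
Proof.
rewrite /convsq sumsetC; apply: eq_bigr => z _; congr (_ ^+ 2).
rewrite /fconv exchange_big; apply: eq_bigr => y _; apply: eq_bigr => x _.
by rewrite addrC [F x * _]mulrC.
Qed.

Lemma fconv_ge0 (R : numDomainType) (G : zmodType) (X Y : {fset G})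
    (F H : G -> R) (z : G) :
  (forall x, x \in X -> 0 <= F x) -> (forall y, y \in Y -> 0 <= H y) ->
  0 <= fconv X Y F H z.
Proof.
move=> F0 H0; rewrite /fconv big_seq; apply: sumr_ge0 => x xX.
rewrite big_seq; apply: sumr_ge0 => y yY.
by rewrite !mulr_ge0 ?ler0n ?F0 ?H0.
Qed.

Lemma convsq_ge0 (R : realDomainType) (G : zmodType) (X Y : {fset G})
    (F H : G -> R) : 0 <= convsq X Y F H.
Proof. by apply: sumr_ge0 => z _; exact: sqr_ge0. Qed.

Lemma le_convsq (R : realDomainType) (G : zmodType) (X Y : {fset G})
    (F1 F2 H : G -> R) :
  (forall x, x \in X -> 0 <= F1 x <= F2 x) ->
  (forall y, y \in Y -> 0 <= H y) ->
  convsq X Y F1 H <= convsq X Y F2 H.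
Proof.
move=> F12 H0; apply: ler_sum => z _.
have F1_0 x : x \in X -> 0 <= F1 x by move/F12/andP=> [].
have F2_0 x : x \in X -> 0 <= F2 x.
  by move/F12/andP=> [] /le_trans; exact.
apply: lerXn2r; rewrite ?nnegrE ?fconv_ge0 //.
rewrite /fconv big_seq_cond [leRHS]big_seq_cond; apply: ler_sum => x.
rewrite andbT => /F12/andP[_ F12x].
rewrite big_seq_cond [leRHS]big_seq_cond; apply: ler_sum => y.
by rewrite andbT => /H0 H0y; rewrite ler_wpM2l ?ler0n // ler_wpM2r.
Qed.

(** The convolution is linear, and (u_1 + ... + u_m)^2 is at most
    m (u_1^2 + ... + u_m^2): a substitute for Minkowski's inequality whose
    loss m is harmless for a bounded number of levels. *)
Lemma convsq_sum_le (R : realDomainType) (G : zmodType) (X Y : {fset G})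
    (m : nat) (c : 'I_m -> R) (A : 'I_m -> G -> R) (H : G -> R) :
  convsq X Y (fun x => \sum_j c j * A j x) H <=
    m%:R * \sum_j c j ^+ 2 * convsq X Y (A j) H.
Proof.
rewrite /convsq.
under [X in _ <= _ * X]eq_bigr do rewrite mulr_sumr.
rewrite exchange_big mulr_sumr; apply: ler_sum => z _.
have -> : fconv X Y (fun x => \sum_j c j * A j x) H z =
    \sum_j c j * fconv X Y (A j) H z.
  rewrite /fconv.
  under [RHS]eq_bigr => j _.
    rewrite mulr_sumr; under eq_bigr do rewrite mulr_sumr; over.
  rewrite [RHS]exchange_big; apply: eq_bigr => x _.
  rewrite [RHS]exchange_big; apply: eq_bigr => y _.
  rewrite mulr_suml mulr_sumr; apply: eq_bigr => j _; ring.
apply: le_trans (sqr_sum_le _) _.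
by under [X in _ <= _ * X]eq_bigr do rewrite -exprMn.
Qed.

(** * Convolutions of indicator functions and additive energy *)

(** Counted in R, where it is compared with real convolutions. *)
Definition repsum (R : pzRingType) (G : zmodType) (A B : {fset G})
    (z : G) : R :=
  \sum_(x <- A) \sum_(y <- B) (x + y == z)%:R.

Definition repdiff (R : pzRingType) (G : zmodType) (A : {fset G}) (t : G) : R :=
  \sum_(x <- A) \sum_(y <- A) (x - y == t)%:R.

Lemma fconv_indic (R : pzRingType) (G : zmodType) (X Y A B : {fset G}) (z : G) :
  A `<=` X -> B `<=` Y ->
  fconv X Y (indic R A) (indic R B) z = repsum R A B z.
Proof.
move=> AX BY; rewrite /fconv /repsum -(big_fset_incl _ AX) /=; last first.
  move=> x _ /negbTE xA; rewrite big1 // => y _.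
  by rewrite /indic xA mul0r mulr0.
apply: eq_big_seq => x xA; rewrite -(big_fset_incl _ BY) /=; last first.
  by move=> y _ /negbTE yB; rewrite /indic yB !mulr0.
by apply: eq_big_seq => y yB; rewrite /indic xA yB !mulr1.
Qed.

Lemma sum_eq_le1 (R : numDomainType) (T : choiceType) (Z : {fset T}) (a : T) :
  \sum_(z <- Z) (a == z)%:R <= 1 :> R.
Proof.
under eq_bigr do rewrite -[_%:R]mulr1.
by rewrite (sum_pick Z a (fun=> 1)) mulr1 lern1 leq_b1.
Qed.

Lemma repsum_ge0 (R : numDomainType) (G : zmodType) (A B : {fset G}) (z : G) :
  0 <= repsum R A B z.
Proof. by apply: sumr_ge0 => x _; apply: sumr_ge0 => y _; exact: ler0n. Qed.

(** Given z, the summand x determines y = z - x. *)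
Lemma repsum_le (R : numDomainType) (G : zmodType) (A B : {fset G}) (z : G) :
  repsum R A B z <= #|` A|%:R.
Proof.
rewrite -[leRHS]mul1r -sum_const_fset; apply: ler_sum => x _.
under eq_bigr => y _.
  have -> : (x + y == z) = (z - x == y) by rewrite subr_eq addrC eq_sym.
  over.
exact: sum_eq_le1.
Qed.

Lemma sum_repsum_le (R : numDomainType) (G : zmodType) (A B Z : {fset G}) :
  \sum_(z <- Z) repsum R A B z <= #|` A|%:R * #|` B|%:R.
Proof.
rewrite /repsum exchange_big mulrC -sum_const_fset; apply: ler_sum => x _.
rewrite exchange_big -[leRHS]mul1r -sum_const_fset; apply: ler_sum => y _.
exact: sum_eq_le1.
Qed.

(** Bound one factor by its maximum |A|; the other one sums to at most the
    number |A| |B| of pairs.  This is Young's inequality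
    ||1_A * 1_B||_2 <= ||1_A||_1 ||1_B||_2. *)
Lemma sum_repsum_sqr_le (R : numDomainType) (G : zmodType) (A B Z : {fset G}) :
  \sum_(z <- Z) repsum R A B z ^+ 2 <= #|` A|%:R ^+ 2 * #|` B|%:R.
Proof.
apply: (@le_trans _ _ (\sum_(z <- Z) #|` A|%:R * repsum R A B z)).
  by apply: ler_sum => z _; rewrite expr2 ler_wpM2r ?repsum_ge0 ?repsum_le.
by rewrite -mulr_sumr expr2 -mulrA ler_wpM2l ?ler0n ?sum_repsum_le.
Qed.

Lemma big_fsetM (V : nmodType) (S T : choiceType) (A : {fset S})
    (B : {fset T}) (F : S * T -> V) :
  \sum_(w <- A `*` B) F w = \sum_(x <- A) \sum_(y <- B) F (x, y).
Proof.
rewrite -big_allpairs.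
apply: perm_big; apply: uniq_perm.
- exact: fset_uniq.
- by apply: allpairs_uniq; [exact: fset_uniq|exact: fset_uniq|move=> [? ?] []].
move=> [x y]; rewrite in_fsetM /=; apply/andP/allpairsP => [[xA yB]|].
  by exists (x, y).
by case=> -[x' y'] /= [x'A y'B [-> ->]].
Qed.

Lemma rdiffE (R : pzRingType) (G : zmodType) (A : {fset G}) (t : G) :
  (rdiff A t)%:R = repdiff R A t.
Proof.
rewrite /repdiff /rdiff -[LHS]mul1r -sum_const_fset -big_fset_condE.
rewrite big_mkcond big_fsetM; apply: eq_bigr => x _; apply: eq_bigr => y _ /=.
by case: eqP.
Qed.

(** Beyond the differences of A nothing is counted, so [T] may be enlarged
    until the energies of two sets are sums over the same range. *)
Lemma energyE (R : pzRingType) (G : zmodType) (A T : {fset G}) :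
  [fset x - y | x in A, y in A] `<=` T ->
  (energy A)%:R = \sum_(t <- T) repdiff R A t ^+ 2.
Proof.
move=> AT; rewrite /energy (fsbigTE T) => [|t tT].
  by rewrite natr_sum; apply: eq_bigr => t _; rewrite natrX (rdiffE R).
suff -> : rdiff A t = 0%N by [].
apply/eqP; rewrite cardfs_eq0; apply/eqP/fsetP => w; rewrite !inE.
apply/negbTE/negP => /andP[/andP[w1 w2] /eqP wt].
by case/negP: tT; apply: (fsubsetP AT); rewrite -wt; exact: in_imfset2.
Qed.

(** The sum over [Z] counts solutions of x + y = x' + y', that is, of
    x - x' = y' - y.  Sorting all of these by the common difference t gives
    the inner product of r_{A-A} and r_{B-B}, whose squared norms are the
    energies. *)
Lemma sum_repsum_sqr_energy (R : realDomainType) (G : zmodType)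
    (A B Z : {fset G}) :
  (\sum_(z <- Z) repsum R A B z ^+ 2) ^+ 2 <= (energy A)%:R * (energy B)%:R.
Proof.
(* One range of differences serving both energies. *)
set T := [fset x - y | x in A, y in A] `|` [fset x - y | x in B, y in B].
rewrite (energyE R (T := T)) ?fsubsetUl // (energyE R (T := T)) ?fsubsetUr //.
apply: le_trans (cauchy_schwarz_seq _ _ _).
apply: lerXn2r; rewrite ?nnegrE.
- by apply: sumr_ge0 => z _; exact: sqr_ge0.
- by apply: sumr_ge0 => t _; apply: mulr_ge0; apply: sumr_ge0 => x _;
     apply: sumr_ge0 => y _; exact: ler0n.
have -> : \sum_(z <- Z) repsum R A B z ^+ 2 =
    \sum_(x <- A) \sum_(x' <- A) \sum_(y <- B) \sum_(y' <- B)
      \sum_(z <- Z) (x + y == z)%:R * (x' + y' == z)%:R.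
  under eq_bigr do rewrite expr2 /repsum big_distrlr /=.
  rewrite exchange_big; apply: eq_bigr => x _.
  rewrite exchange_big; apply: eq_bigr => x' _.
  under eq_bigr do rewrite big_distrlr /=.
  rewrite exchange_big; apply: eq_bigr => y _.
  by rewrite exchange_big.
have -> : \sum_(t <- T) repdiff R A t * repdiff R B t =
    \sum_(x <- A) \sum_(x' <- A) \sum_(y <- B) \sum_(y' <- B)
      \sum_(t <- T) (x - x' == t)%:R * (y' - y == t)%:R.
  under eq_bigr do rewrite /repdiff [X in _ * X]exchange_big mulr_suml.
  rewrite exchange_big; apply: eq_bigr => x _.
  under eq_bigr do rewrite mulr_suml.
  rewrite exchange_big; apply: eq_bigr => x' _.
  under eq_bigr do rewrite mulr_sumr.
  rewrite exchange_big; apply: eq_bigr => y _.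
  under eq_bigr do rewrite mulr_sumr.
  by rewrite exchange_big.
rewrite big_seq [leRHS]big_seq; apply: ler_sum => x xA.
rewrite big_seq [leRHS]big_seq; apply: ler_sum => x' x'A.
rewrite big_seq [leRHS]big_seq; apply: ler_sum => y yB.
rewrite big_seq [leRHS]big_seq; apply: ler_sum => y' y'B.
rewrite !sum_pick.
have -> : x - x' \in T by rewrite inE; apply/orP; left; exact: in_imfset2.
rewrite mul1r (_ : (y' - y == x - x') = (x' + y' == x + y)); last first.
  by rewrite subr_eq addrAC [LHS]eq_sym subr_eq [RHS]eq_sym [x' + y']addrC.
by rewrite ler_piMl ?ler0n // lern1 leq_b1.
Qed.

(** * Reduction to nonnegative functions *)

Lemma convE (K : nzRingType) (G : zmodType) (X Y : {fset G}) (f g : G -> K)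
    (z : G) :
  supported_on f X -> supported_on g Y ->
  conv f g z = \sum_(x <- X) \sum_(y <- Y) (x + y == z)%:R * (f x * g y).
Proof.
move=> fX gY; rewrite /conv.
rewrite (fsbigE [fset w in X `*` Y | w.1 + w.2 == z]); last first.
- move=> w /= wz; rewrite !inE /= wz eqxx andbT negb_and => /orP[/fX|/gY] ->.
    by rewrite mul0r.
  by rewrite mulr0.
- by move=> w /=; rewrite !inE => /andP[_ /eqP].
- exact: fset_uniq.
transitivity (\sum_(w <- [fset w in X `*` Y | w.1 + w.2 == z]) f w.1 * g w.2).
  rewrite big_seq_cond [RHS]big_seq; apply: eq_bigl => w.
  rewrite !inE /=; apply: andb_idr => /andP[_ /eqP wz].
  by rewrite in_setE.
rewrite -big_fset_condE big_mkcond big_fsetM.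
apply: eq_bigr => x _; apply: eq_bigr => y _ /=.
by case: eqP; rewrite ?mul1r ?mul0r.
Qed.

Lemma normc_sum_le (R : rcfType) (I : Type) (s : seq I) (F : I -> R[i]) :
  ComplexField.Normc.normc (\sum_(i <- s) F i) <=
    \sum_(i <- s) ComplexField.Normc.normc (F i).
Proof.
apply: (big_ind2 (fun (a : R[i]) b => ComplexField.Normc.normc a <= b)) => //.
  by rewrite ComplexField.Normc.normc0.
by move=> a b c d ab cd; apply: le_trans (le_normcD _ _) _; exact: lerD.
Qed.

Lemma lpnormE (R : realType) (G : zmodType) (X : {fset G}) (p : R)
    (f : G -> R[i]) :
  p != 0 -> supported_on f X ->
  lpnorm p f = (\sum_(x <- X) ComplexField.Normc.normc (f x) `^ p) `^ p^-1.
Proof.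
move=> p0 fX; rewrite /lpnorm (fsbigTE X) // => x /fX ->.
by rewrite ComplexField.Normc.normc0 powR0.
Qed.

Lemma normc_ge0 (R : rcfType) (z : R[i]) : 0 <= ComplexField.Normc.normc z.
Proof. by case: z => a b; exact: sqrtr_ge0. Qed.

Lemma lpnorm2_conv_le (R : realType) (G : zmodType) (X Y : {fset G})
    (f g : G -> R[i]) :
  supported_on f X -> supported_on g Y ->
  lpnorm 2 (conv f g) <=
    Num.sqrt (convsq X Y (fun x => ComplexField.Normc.normc (f x))
                         (fun y => ComplexField.Normc.normc (g y))).
Proof.
move=> fX gY.
have supp : supported_on (conv f g) (sumset X Y).
  move=> z zXY; rewrite (convE z fX gY) big_seq big1 // => x xX.
  rewrite big_seq big1 // => y yY.
  case: eqP => [xyz|_]; last by rewrite mul0r.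
  by case/negP: zXY; rewrite -xyz; exact: in_imfset2.
rewrite (lpnormE _ supp) ?pnatr_eq0 // powR12_sqrt; last first.
  by apply: sumr_ge0 => z _; exact: powR_ge0.
rewrite ler_sqrt ?convsq_ge0 //; apply: ler_sum => z _.
rewrite powR_mulrn ?normc_ge0 //.
apply: lerXn2r; rewrite ?nnegrE ?normc_ge0 //.
  by apply: fconv_ge0 => *; exact: normc_ge0.
rewrite (convE z fX gY); apply: le_trans (normc_sum_le _ _) _.
apply: ler_sum => x _; apply: le_trans (normc_sum_le _ _) _.
apply: ler_sum => y _; rewrite /= -ComplexField.Normc.normcM.
case: eqP => _; first by rewrite !mul1r.
by rewrite !mul0r ComplexField.Normc.normc0.
Qed.

(** The level decomposition is used twice.  For a fixed set A the functional
    convsq X Y 1_A is bounded on indicators by hypothesis, so it is bounded on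
    H; for this H the functional F |-> convsq X Y F H is then bounded on
    indicators, so it is bounded on F. *)
Lemma convsq_le_levels (R : realType) (G : zmodType) (X Y : {fset G})
    (p q D : R) (J : nat) :
  1 <= p -> 1 <= q -> 0 <= D -> (0 < J)%N ->
  (forall A B : {fset G}, A `<=` X -> B `<=` Y ->
     convsq X Y (indic R A) (indic R B) <=
       D * (#|` A|%:R `^ p^-1) ^+ 2 * (#|` B|%:R `^ q^-1) ^+ 2) ->
  forall F H : G -> R,
  (forall x, x \in X -> 0 <= F x) -> (forall y, y \in Y -> 0 <= H y) ->
  convsq X Y F H <=
    J.+1%:R ^+ 4 * D * ((#|` X| * #|` Y|)%:R `^ J%:R^-1) ^+ 2 *
    ((\sum_(x <- X) F x `^ p) `^ p^-1) ^+ 2 *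
    ((\sum_(y <- Y) H y `^ q) `^ q^-1) ^+ 2.
Proof.
move=> p1 q1 D0 J0 setXY F H F0 H0.
set MF := (\sum_(x <- X) F x `^ p) `^ p^-1.
set MH := (\sum_(y <- Y) H y `^ q) `^ q^-1.
have indic_ge0 (A : {fset G}) x : 0 <= indic R A x by exact: ler0n.
have setX (A : {fset G}) : A `<=` X ->
    convsq X Y (indic R A) H <=
      J.+1%:R ^+ 2 * D * (#|` Y|%:R `^ J%:R^-1) ^+ 2 * MH ^+ 2 *
      (#|` A|%:R `^ p^-1) ^+ 2.
  move=> AX.
  have -> : J.+1%:R ^+ 2 * D * (#|` Y|%:R `^ J%:R^-1) ^+ 2 * MH ^+ 2 *
      (#|` A|%:R `^ p^-1) ^+ 2 =
    J.+1%:R ^+ 2 * (D * (#|` A|%:R `^ p^-1) ^+ 2) *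
      (#|` Y|%:R `^ J%:R^-1) ^+ 2 * MH ^+ 2 by ring.
  apply: (level_decomposition (Phi := fun H => convsq X Y (indic R A) H)) => //.
  - move=> H1 H2 H12; rewrite ![convsq X Y _ _]convsqC.
    exact: le_convsq.
  - move=> m c B; rewrite /= convsqC.
    under eq_bigr do rewrite convsqC.
    exact: convsq_sum_le.
  - by nonneg.
  - by move=> B BY; exact: setXY.
have -> : J.+1%:R ^+ 4 * D * ((#|` X| * #|` Y|)%:R `^ J%:R^-1) ^+ 2 *
    MF ^+ 2 * MH ^+ 2 =
  J.+1%:R ^+ 2 *
    (J.+1%:R ^+ 2 * D * (#|` Y|%:R `^ J%:R^-1) ^+ 2 * MH ^+ 2) *
    (#|` X|%:R `^ J%:R^-1) ^+ 2 * MF ^+ 2.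
  rewrite natrM (powRM _ (ler0n _ _) (ler0n _ _)).
  move: (_ `^ J%:R^-1) (_ `^ J%:R^-1) (MF) (MH) (J.+1%:R : R).
  by move=> u v w z c; ring.
apply: (level_decomposition (Phi := fun F => convsq X Y F H)) => //.
- by move=> F1 F2 F12; exact: le_convsq.
- by move=> m c A; exact: convsq_sum_le.
- by nonneg.
Qed.

(** * The theorem *)

(** The geometric mean of sqrt(E(A) E(B)), |A|^2 |B| and |A| |B|^2 with
    weights t0, t1, t2; p and q are defined so that the exponents of |A| and
    |B| are 2/p and 2/q, plus t0 eta / 2. *)
Lemma convsq_indic_le (R : realType) (G : zmodType) (X Y A B : {fset G})
    (aX aY t0 t1 t2 eta CX CY p q : R) :
  A `<=` X -> B `<=` Y ->
  0 <= t0 -> 0 <= t1 -> 0 <= t2 -> t0 + t1 + t2 = 1 -> 0 <= CX -> 0 <= CY ->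
  (energy A)%:R <= CX * #|` A|%:R `^ (aX + eta) ->
  (energy B)%:R <= CY * #|` B|%:R `^ (aY + eta) ->
  p^-1 = t0 * (aX / 4) + t1 + t2 / 2 ->
  q^-1 = t0 * (aY / 4) + t1 / 2 + t2 ->
  convsq X Y (indic R A) (indic R B) <=
    (CX * CY) `^ (t0 / 2) * (#|` A|%:R `^ (p^-1 + t0 * eta / 4)) ^+ 2
                          * (#|` B|%:R `^ (q^-1 + t0 * eta / 4)) ^+ 2.
Proof.
move=> AX BY t00 t10 t20 tE CX0 CY0 EA EB pE qE.
set n : R := #|` A|%:R; set m : R := #|` B|%:R.
have n0 : 0 <= n by exact: ler0n.
have m0 : 0 <= m by exact: ler0n.
have QE : convsq X Y (indic R A) (indic R B) =
    \sum_(z <- sumset X Y) repsum R A B z ^+ 2.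
  by apply: eq_bigr => z _; rewrite fconv_indic.
have Q1 : convsq X Y (indic R A) (indic R B) <= n ^+ 2 * m.
  by rewrite QE sum_repsum_sqr_le.
have Q2 : convsq X Y (indic R A) (indic R B) <= m ^+ 2 * n.
  rewrite convsqC (le_trans _ (sum_repsum_sqr_le R B A (sumset Y X))) //.
  by apply: ler_sum => z _; rewrite fconv_indic.
have [n_eq0|n_neq0] := eqVneq n 0.
  by apply: (le_trans Q1); rewrite n_eq0 expr0n mul0r; nonneg.
have [m_eq0|m_neq0] := eqVneq m 0.
  by apply: (le_trans Q1); rewrite m_eq0 mulr0; nonneg.
pose M0 := ((CX * n `^ (aX + eta)) * (CY * m `^ (aY + eta))) `^ 2^-1.
have QM0 : convsq X Y (indic R A) (indic R B) <= M0.
  have -> : convsq X Y (indic R A) (indic R B) =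
      (convsq X Y (indic R A) (indic R B) ^+ 2) `^ 2^-1.
    by rewrite powR12_sqrt ?sqr_ge0 // sqrtr_sqr ger0_norm // convsq_ge0.
  apply: ge0_ler_powR; rewrite ?nnegrE ?invr_ge0 ?ler0n ?sqr_ge0 //.
    by nonneg.
  rewrite QE; apply: le_trans (sum_repsum_sqr_energy _ _ _ _) _.
  by apply: ler_pM.
apply: (le_trans (interpolate3 (convsq_ge0 _ _ _ _) QM0 Q1 Q2 t00 t10 t20 tE)).
have nE : n `^ ((aX + eta) * (t0 / 2)) * n `^ (2 * t1) * n `^ t2 =
    (n `^ (p^-1 + t0 * eta / 4)) ^+ 2.
  rewrite -!powRD ?n_neq0 ?implybT // -powR_mulrn ?powR_ge0 // -powRrM pE.
  by congr (_ `^ _); field.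
have mE : m `^ ((aY + eta) * (t0 / 2)) * m `^ t1 * m `^ (2 * t2) =
    (m `^ (q^-1 + t0 * eta / 4)) ^+ 2.
  rewrite -!powRD ?m_neq0 ?implybT // -powR_mulrn ?powR_ge0 // -powRrM qE.
  by congr (_ `^ _); field.
rewrite -nE -mE le_eqVlt; apply/orP; left; apply/eqP.
have -> : M0 `^ t0 = (CX * CY) `^ (t0 / 2) *
    (n `^ ((aX + eta) * (t0 / 2)) * m `^ ((aY + eta) * (t0 / 2))).
  rewrite /M0 -powRrM (_ : 2^-1 * t0 = t0 / 2); last by rewrite mulrC.
  rewrite mulrACA (powRM _ (mulr_ge0 CX0 CY0)); last by nonneg.
  by rewrite (powRM _ (powR_ge0 n _) (powR_ge0 m _)) -!powRrM.
have npow (x t : R) : 0 <= x -> (x ^+ 2) `^ t = x `^ (2 * t).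
  by move=> x0; rewrite -powR_mulrn // -powRrM.
rewrite (powRM _ (sqr_ge0 n) m0) (powRM _ (sqr_ge0 m) n0) !npow //.
by rewrite !mulrA; do 2 rewrite [in RHS]mulrAC; ring.
Qed.

(** A cardinality is 0 or at least 1, so its powers increase with the
    exponent; a positive [s] makes the powers of 0 vanish. *)
Lemma powR_card_le (R : realType) (T : choiceType) (A X : {fset T})
    (s s' e : R) :
  A `<=` X -> 0 < s -> s <= s' -> 0 <= e ->
  #|` A|%:R `^ (s + e) <= #|` A|%:R `^ s' * #|` X|%:R `^ e.
Proof.
move=> AX s0 ss' e0.
have [A0|] := posnP #|` A|.
  by rewrite A0 powR0 ?gt_eqF ?ltr_wpDr //; nonneg.
rewrite -(ler1n R) => A1.
have An0 : #|` A|%:R != 0 :> R by rewrite gt_eqF // (lt_le_trans ltr01).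
rewrite powRD ?An0 ?implybT //; apply: ler_pM; rewrite ?powR_ge0 ?ler_powR //.
by apply: ge0_ler_powR; rewrite ?nnegrE ?ler_nat ?fsubset_leq_card.
Qed.

(** The estimate for fixed eta and J.  Two powers of |X| |Y| are lost: the
    exponent t0 eta / 4 comes from the energy hypothesis and 1 / J from the
    ratio of consecutive levels. *)
Lemma lpnorm2_conv_le_energy (R : realType) (aX aY t0 t1 t2 eta CX CY : R)
    (p q p' q' : R) (J : nat) (G : zmodType) (X Y : {fset G})
    (f g : G -> R[i]) :
  0 <= t0 -> 0 <= t1 -> 0 <= t2 -> t0 + t1 + t2 = 1 ->
  p^-1 = t0 * (aX / 4) + t1 + t2 / 2 ->
  q^-1 = t0 * (aY / 4) + t1 / 2 + t2 ->
  1 <= p' <= p -> 1 <= q' <= q -> 0 <= eta -> 0 <= CX -> 0 <= CY ->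
  (0 < J)%N ->
  (forall A : {fset G}, A `<=` X ->
     (energy A)%:R <= CX * #|` A|%:R `^ (aX + eta)) ->
  (forall B : {fset G}, B `<=` Y ->
     (energy B)%:R <= CY * #|` B|%:R `^ (aY + eta)) ->
  supported_on f X -> supported_on g Y ->
  lpnorm 2 (conv f g) <=
    J.+1%:R ^+ 2 * (CX * CY) `^ (t0 / 4) *
    ((#|` X| * #|` Y|)%:R `^ (t0 * eta / 4) *
     (#|` X| * #|` Y|)%:R `^ J%:R^-1) * lpnorm p' f * lpnorm q' g.
Proof.
move=> t00 t10 t20 tE pE qE /andP[p'1 p'p] /andP[q'1 q'q] eta0 CX0 CY0 J0.
move=> EX EY fX gY.
have p'0 : 0 < p' by exact: lt_le_trans p'1.
have q'0 : 0 < q' by exact: lt_le_trans q'1.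
have p0 : 0 < p by exact: lt_le_trans p'p.
have q0 : 0 < q by exact: lt_le_trans q'q.
rewrite (lpnormE (lt0r_neq0 p'0) fX) (lpnormE (lt0r_neq0 q'0) gY).
set N : R := (#|` X| * #|` Y|)%:R.
pose D := (CX * CY) `^ (t0 / 2) * (N `^ (t0 * eta / 4)) ^+ 2.
have e0 : 0 <= t0 * eta / 4 by rewrite divr_ge0 // mulr_ge0.
apply: (le_trans (lpnorm2_conv_le fX gY)).
set MF := (\sum_(x <- X) _) `^ p'^-1; set MH := (\sum_(y <- Y) _) `^ q'^-1.
set bound := (X in _ <= X).
have bound0 : 0 <= bound by rewrite /bound; nonneg.
rewrite -(ger0_norm bound0) -sqrtr_sqr ler_sqrt ?sqr_ge0 //.
have -> : bound ^+ 2 =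
    J.+1%:R ^+ 4 * D * (N `^ J%:R^-1) ^+ 2 * MF ^+ 2 * MH ^+ 2.
  rewrite /bound /D.
  have -> : (CX * CY) `^ (t0 / 2) = ((CX * CY) `^ (t0 / 4)) ^+ 2.
    by rewrite -powR_mulrn ?powR_ge0 // -powRrM; congr (_ `^ _); field.
  move: (_ `^ (t0 / 4)) (N `^ _) (N `^ _) (MF) (MH) (J.+1%:R : R).
  by move=> a b c d e k; ring.
apply: convsq_le_levels => //; last 2 first.
- by move=> x _; exact: normc_ge0.
- by move=> x _; exact: normc_ge0.
- by rewrite /D; nonneg.
move=> A B AX BY.
apply: (le_trans (convsq_indic_le AX BY t00 t10 t20 tE CX0 CY0
                    (EX _ AX) (EY _ BY) pE qE)).
have lA : #|` A|%:R `^ (p^-1 + t0 * eta / 4) <=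
    #|` A|%:R `^ p'^-1 * #|` X|%:R `^ (t0 * eta / 4).
  by apply: powR_card_le; rewrite ?invr_gt0 ?lef_pV2.
have lB : #|` B|%:R `^ (q^-1 + t0 * eta / 4) <=
    #|` B|%:R `^ q'^-1 * #|` Y|%:R `^ (t0 * eta / 4).
  by apply: powR_card_le; rewrite ?invr_gt0 ?lef_pV2.
have -> : D * (#|` A|%:R `^ p'^-1) ^+ 2 * (#|` B|%:R `^ q'^-1) ^+ 2 =
  (CX * CY) `^ (t0 / 2) * (#|` A|%:R `^ p'^-1 * #|` X|%:R `^ (t0 * eta / 4)) ^+ 2
    * (#|` B|%:R `^ q'^-1 * #|` Y|%:R `^ (t0 * eta / 4)) ^+ 2.
  rewrite /D /N natrM (powRM _ (ler0n _ _) (ler0n _ _)).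
  move: (#|` X|%:R `^ _) (#|` Y|%:R `^ _) (#|` A|%:R `^ _) (#|` B|%:R `^ _).
  by move=> a b c d; ring.
apply: ler_pM; try by nonneg.
  apply: ler_wpM2l; first by nonneg.
  by apply: lerXn2r; rewrite ?nnegrE //; nonneg.
by apply: lerXn2r; rewrite ?nnegrE //; nonneg.
Qed.

Theorem theorem5p3 (R : realType) (aX aY theta0 theta1 theta2 : R)
    (Ceta : R -> R) (p q : R) :
  2 <= aX < 3 -> 2 <= aY < 3 ->
  0 <= theta0 -> 0 <= theta1 -> 0 <= theta2 ->
  theta0 + theta1 + theta2 = 1 ->
  p^-1 = theta0 * (aX / 4) + theta1 + theta2 / 2 ->
  q^-1 = theta0 * (aY / 4) + theta1 / 2 + theta2 ->
  forall eps : R, 0 < eps ->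
  exists C : R,
    forall (G : zmodType) (X Y : {fset G}) (KX KY : R),
      torsion_free G -> 1 <= KX -> 1 <= KY ->
      (forall eta : R, 0 < eta ->
        (forall A : {fset G}, A `<=` X ->
          (energy A)%:R
            <= Ceta eta * KX `^ (3 - aX) * (#|` A|%:R) `^ (aX + eta)) /\
        (forall B : {fset G}, B `<=` Y ->
          (energy B)%:R
            <= Ceta eta * KY `^ (3 - aY) * (#|` B|%:R) `^ (aY + eta))) ->
      forall f g : G -> R[i], supported_on f X -> supported_on g Y ->
        lpnorm 2 (conv f g)
          <= C * KX `^ (theta0 * (3 - aX) / 4) * KY `^ (theta0 * (3 - aY) / 4)
             * ((#|` X| * #|` Y|)%:R) `^ eps * lpnorm p f * lpnorm q g /\
        (forall p' q' : R, 1 <= p' <= p -> 1 <= q' <= q ->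
          lpnorm 2 (conv f g)
            <= C * KX `^ (theta0 * (3 - aX) / 4)
               * KY `^ (theta0 * (3 - aY) / 4)
               * ((#|` X| * #|` Y|)%:R) `^ eps * lpnorm p' f * lpnorm q' g).
Proof.
move=> /andP[aX2 aX3] /andP[aY2 aY3] t00 t10 t20 tE pE qE eps eps0.
(* 1 / J <= eps / 2, and eta = eps costs at most eps / 4. *)
pose J := (Num.truncn (2 / eps)).+1.
(* For empty X and Y the energy hypothesis allows Ceta eps to be negative. *)
pose C0 := Num.max 0 (Ceta eps).
have C00 : 0 <= C0 by rewrite /C0 le_max lexx.
exists (J.+1%:R ^+ 2 * C0 `^ (theta0 / 2)) => G X Y KX KY _ KX1 KY1 hE f g fX gY.
have KX0 : 0 <= KX by exact: le_trans KX1.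
have KY0 : 0 <= KY by exact: le_trans KY1.
have inv_ge1 (r s : R) : r^-1 = s -> 0 < s -> s <= 1 -> 1 <= r.
  by move=> rs s0 s1; rewrite -[r]invrK rs invf_ge1.
have p1 : 1 <= p by apply: (inv_ge1 _ _ pE); nra.
have q1 : 1 <= q by apply: (inv_ge1 _ _ qE); nra.
suff bound p' q' : 1 <= p' <= p -> 1 <= q' <= q ->
    lpnorm 2 (conv f g) <= J.+1%:R ^+ 2 * C0 `^ (theta0 / 2)
      * KX `^ (theta0 * (3 - aX) / 4) * KY `^ (theta0 * (3 - aY) / 4)
      * ((#|` X| * #|` Y|)%:R) `^ eps * lpnorm p' f * lpnorm q' g.
  by split=> //; apply: bound; rewrite lexx andbT.
move=> p'p q'q.
have [EX EY] := hE eps eps0.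
have J0 : 0 < J%:R :> R by rewrite ltr0n.
have Jinv : J%:R^-1 <= eps / 2.
  rewrite -[leRHS]invrK invf_div lef_pV2 ?posrE ?divr_gt0 //.
  by rewrite ltW // /J truncnS_gt.
have EX' (A : {fset G}) : A `<=` X ->
    (energy A)%:R <= C0 * KX `^ (3 - aX) * #|` A|%:R `^ (aX + eps).
  move/EX/le_trans; apply; rewrite !ler_wpM2r ?powR_ge0 //.
  by rewrite /C0 le_max lexx orbT.
have EY' (B : {fset G}) : B `<=` Y ->
    (energy B)%:R <= C0 * KY `^ (3 - aY) * #|` B|%:R `^ (aY + eps).
  move/EY/le_trans; apply; rewrite !ler_wpM2r ?powR_ge0 //.
  by rewrite /C0 le_max lexx orbT.
have CX0 : 0 <= C0 * KX `^ (3 - aX) by nonneg.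
have CY0 : 0 <= C0 * KY `^ (3 - aY) by nonneg.
apply: (le_trans (lpnorm2_conv_le_energy t00 t10 t20 tE pE qE p'p q'q
          (ltW eps0) CX0 CY0 (ltn0Sn _ : (0 < J)%N) EX' EY' fX gY)).
set N : R := (#|` X| * #|` Y|)%:R.
have NE : N `^ (theta0 * eps / 4) * N `^ J%:R^-1 <= N `^ eps.
  have [N0|] := posnP (#|` X| * #|` Y|)%N.
    by rewrite /N N0 [X in _ * X]powR0 ?invr_eq0 ?gt_eqF // mulr0 powR_ge0.
  rewrite -(ler1n R) -/N => N1.
  have Nn0 : N != 0 by rewrite gt_eqF // (lt_le_trans ltr01).
  rewrite -powRD ?Nn0 ?implybT //; apply: ler_powR => //.
  nra.
have -> : (C0 * KX `^ (3 - aX) * (C0 * KY `^ (3 - aY))) `^ (theta0 / 4) =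
    C0 `^ (theta0 / 2) * KX `^ (theta0 * (3 - aX) / 4)
      * KY `^ (theta0 * (3 - aY) / 4).
  rewrite mulrACA -expr2 (powRM _ (sqr_ge0 C0)); last by nonneg.
  rewrite (powRM _ (powR_ge0 KX _) (powR_ge0 KY _)).
  rewrite -powR_mulrn // -!powRrM mulrA.
  by congr (_ `^ _ * _ `^ _ * _ `^ _); field.
do 2 (apply: ler_wpM2r; first exact: powR_ge0).
rewrite !(mulrA (J.+1%:R ^+ 2)).
by apply: ler_wpM2l => //; nonneg.
Qed.
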